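(* Let $\Delta,\Sigma,\Gamma$ be finite alphabets, and let $\rho:\Delta\times n\to\Sigma$ and $\pi:\Sigma\times m\to\Gamma$ be well-defined order-preserving BMRS interpretations. Let $\rho\otimes\pi := ((\rho')_b \otimes \pi')^\dagger : \Delta\times mn\to\Gamma$ (constructions described in the context). Then $[\![\rho\otimes\pi]\!] = [\![\rho]\!]\circ[\![\pi]\!]$.
   Context: Strings as structures: for a finite alphabet $\Sigma$, a string $s\in\Sigma^\star$ is identified with the structure with domain $\{0,\dots,|s|-1\}$, a unary predicate $\sigma$ for each $\sigma\in\Sigma$ true at indices carrying $\sigma$, predicates $\min$ (true only at $0$), $\max$ (true only at $|s|-1$), and functions $\mathrm{S}$ ($x\mapsto x+1$, fixing $|s|-1$) and $\mathrm{P}$ ($x\mapsto x-1$, fixing $0$). BMRS: with a single variable $\mathtt{x}$ and recursive function names, $\Sigma$-terms are index terms ($\mathtt{x}$, $\mathrm{S}(T)$, $\mathrm{P}(T)$, index if-then-else) and boolean terms ($\mathtt{tt}$, $\mathtt{ff}$, $\mathtt{f}(T)$, $\sigma(T)$ for $\sigma\in\Sigma$, $\max(T)$, $\min(T)$ for index terms $T$, and boolean if-then-else $\mathtt{if}\ T_0\ \mathtt{then}\ T_1\ \mathtt{else}\ T_2$). A headless $\Sigma$-BMRS $p$ is a finite set of definitions $\mathtt{f}_i(\mathtt{x})=T_i$ ($0\le i\le k$) with $T_i$ boolean terms mentioning only $\mathtt{f}_0,\dots,\mathtt{f}_k$ ($p$-terms). Evaluation $s,x\vdash_p T\to v$ is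 the least relation with: $\mathtt{x}\to x$; $\mathtt{tt}\to\top$; $\mathtt{ff}\to\bot$; if $T\to v$ then $\mathrm{S}(T)\to\min(v+1,|s|-1)$, $\mathrm{P}(T)\to\max(v-1,0)$, $\min(T)\to(v=0)$, $\max(T)\to(v=|s|-1)$, $\sigma(T)\to$ (index $v$ carries $\sigma$); if $T\to v$ and $s,v\vdash_p T_i\to w$ then $\mathtt{f}_i(T)\to w$; if-then-else evaluates the guard and then the chosen branch. A $\Sigma$-BMRS is a body $p$ plus finitely many $p$-terms called heads. Interpretations: $\pi:\Sigma\times m\to\Gamma$ is a $\Gamma$-BMRS with heads $\pi(\sigma,i)$, $\sigma\in\Sigma$, $i<m$. Well-defined: for all $s\in\Gamma^\star,i<m,x<|s|$, $s,x\vdash\pi(\sigma,i)\to\top$ for at most one $\sigma$ and $\to\bot$ for all other $\tau\in\Sigma$; strict: additionally exactly one such $\sigma$. For well-defined $\pi$, $[\![\pi]\!](s)$ is obtained by listing the pairs $(q,r)\in|s|\times m$ (lexicographically, $q$ more significant) for which some $\pi(\sigma,r)$ evaluates to $\top$ at $q$, and writing that $\sigma$ for each such pair. Blanks: $\square$ is a fresh symbol, $\Sigma_\square=\Sigma\cup\{\square\}$, and $d$ deletes all $\square$'s from a string. Strictification: for $\pi:\Sigma\times m\to\Gamma$, $\pi':\Sigma_\square\times m\to\Gamma$ has the same body, $\pi'(\sigma,i)=\pi(\sigma,i)$ for $\sigma\in\Sigma$, and $\pi'(\square,i)$ is a boolean term (nested if-then-else) evaluating to $\top$ iff every $\pi(\sigma,i)$,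 $\sigma\in\Sigma$, evaluates to $\bot$, and to $\bot$ if some $\pi(\sigma,i)$ evaluates to $\top$. De-strictification: for $\pi:\Sigma_\square\times m\to\Gamma$, $\pi^\dagger:\Sigma\times m\to\Gamma$ has the same body and heads $\pi^\dagger(\sigma,i)=\pi(\sigma,i)$ for $\sigma\in\Sigma$ (the heads for $\square$ are dropped). Strict composition: for $\pi:\Sigma\times m\to\Gamma$, $\rho:\Delta\times n\to\Sigma$ and $q<m$, let $\rho^\pi_q$ be the $\Gamma$-BMRS obtained from the body of $\rho$ by adjoining the body of $\pi$ (renaming recursive names apart) and replacing each character symbol $\sigma\in\Sigma$ by the head $\pi(\sigma,q)$ (i.e. treating $\sigma$ as a recursive function defined by $\sigma(\mathtt{x})=\pi(\sigma,q)$). Then $\rho\otimes\pi:\Delta\times mn\to\Gamma$ has body the union of the bodies of the $\rho^\pi_q$ ($q<m$) and, for $i=nq+r$ with $r<n$, head $(\rho\otimes\pi)(\delta,i)=\rho(\delta,r)$ read in $\rho^\pi_q$. Normal form: a BMRS (body and heads) is in normal form if every occurrence of $\max$, $\min$, or a character predicate is applied to $\mathtt{x}$, and every recursive call has the form $\mathtt{f}(\mathtt{x})$, $\mathtt{f}(\mathrm{S}\mathtt{x})$ or $\mathtt{f}(\mathrm{P}\mathtt{x})$; every interpretation can be converted (by adding auxiliary recursive functions) into one in normal form whose heads evaluate identically on all strings and indices. Blank enrichment: for a strict $\pi:\Sigma_\square\times m\to\Gamma$ in normal form with body $p$, define $p^\star$ and $T^\star$ as follows. Add recursive functions $\mathrm{maxc},\mathrm{minc}$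 such that on any $s\in\Gamma_\square^\star$ and non-blank index $x$, $\mathrm{maxc}(x)\to\top$ if no non-blank index exceeds $x$ and $\to\bot$ otherwise, and symmetrically for $\mathrm{minc}$ (e.g. $\mathrm{maxc}(\mathtt{x})=\mathtt{if}\ \square(\mathtt{x})\ \mathtt{then}\ \mathtt{ff}\ \mathtt{else}\ \mathtt{g}(\mathtt{x})$, $\mathtt{g}(\mathtt{x})=\mathtt{if}\ \max(\mathtt{x})\ \mathtt{then}\ \mathtt{tt}\ \mathtt{else}\ \mathtt{h}(\mathrm{S}\mathtt{x})$, $\mathtt{h}(\mathtt{x})=\mathtt{if}\ \square(\mathtt{x})\ \mathtt{then}\ \mathtt{g}(\mathtt{x})\ \mathtt{else}\ \mathtt{ff}$). For normal-form boolean terms: $\mathtt{tt}^\star=\mathtt{tt}$, $\mathtt{ff}^\star=\mathtt{ff}$, $\gamma(\mathtt{x})^\star=\gamma(\mathtt{x})$, $\max(\mathtt{x})^\star=\mathrm{maxc}(\mathtt{x})$, $\min(\mathtt{x})^\star=\mathrm{minc}(\mathtt{x})$, $\mathtt{f}(\mathtt{x})^\star=\mathtt{f}^\star(\mathtt{x})$, $\mathtt{f}(\mathrm{S}\mathtt{x})^\star=\mathtt{f}^S(\mathrm{S}\mathtt{x})$, $\mathtt{f}(\mathrm{P}\mathtt{x})^\star=\mathtt{f}^P(\mathrm{P}\mathtt{x})$, and $(\mathtt{if}\ T_0\ \mathtt{then}\ T_1\ \mathtt{else}\ T_2)^\star=\mathtt{if}\ T_0^\star\ \mathtt{then}\ T_1^\star\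 \mathtt{else}\ T_2^\star$, where $\mathtt{f}^\star,\mathtt{f}^S,\mathtt{f}^P$ are fresh names. If $p=\{\mathtt{f}_i(\mathtt{x})=T_i\}$, then $p^\star$ consists of $\mathtt{f}_i^\star(\mathtt{x})=T_i^\star$, $\mathtt{f}_i^S(\mathtt{x})=\mathtt{if}\ \square(\mathtt{x})\ \mathtt{then}\ \mathtt{f}_i^S(\mathrm{S}\mathtt{x})\ \mathtt{else}\ T_i^\star$, $\mathtt{f}_i^P(\mathtt{x})=\mathtt{if}\ \square(\mathtt{x})\ \mathtt{then}\ \mathtt{f}_i^P(\mathrm{P}\mathtt{x})\ \mathtt{else}\ T_i^\star$, plus the definitions of $\mathrm{maxc},\mathrm{minc}$. Then $\pi_b:\Sigma_\square\times m\to\Gamma_\square$ has body $p^\star$, heads $\pi_b(\sigma,i)=\mathtt{if}\ \square(\mathtt{x})\ \mathtt{then}\ \mathtt{ff}\ \mathtt{else}\ \pi(\sigma,i)^\star$ for $\sigma\in\Sigma$, and $\pi_b(\square,i)=\mathtt{if}\ \square(\mathtt{x})\ \mathtt{then}\ \mathtt{tt}\ \mathtt{else}\ \pi(\square,i)^\star$. In the claim, $(\rho')_b$ is the blank enrichment of (a normal form of) the strictification $\rho':\Delta_\square\times n\to\Sigma$, so $(\rho')_b:\Delta_\square\times n\to\Sigma_\square$; $\pi':\Sigma_\square\times m\to\Gamma$; their strict composition is $\Delta_\square\times mn\to\Gamma$, and $\dagger$ is de-strictification.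
   Formalization: In strict composition, S, P, max, min of ρ are read in the ordered product |s|×m (S goes from copy q to q+1, then to copy 0 at the next index), not inside copy q; the equality is for normal forms of ρ′ making ρ⊗π well-defined, and one is shown to exist. *)

(* Defs.v *)
From HB Require Import structures.
From mathcomp Require Import all_boot.
From mathcomp Require Import boolp.

Set Implicit Arguments.
Unset Strict Implicit.
Unset Printing Implicit Defensive.

(* Terms over the alphabet [A] with recursive function names in [F]; the names
   a term may mention are controlled by its type. *)
Inductive iterm (A F : Type) : Type :=
  | IVar
  | ISucc of iterm A F
  | IPred of iterm A F
  | IIf of bterm A F & iterm A F & iterm A F
with bterm (A F : Type) : Type :=
  | BTrue
  | BFalse
  | BCall of F & iterm A F
  | BChar of A & iterm A F
  | BMax of iterm A F
  | BMin of iterm A F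
  | BIf of bterm A F & bterm A F & bterm A F.

Arguments IVar {A F}.
Arguments BTrue {A F}.
Arguments BFalse {A F}.
Arguments BCall {A F}.
Arguments BChar {A F}.

(* [ieval p s x T v] and [beval p s x T v] are "s, x |-_p T -> v".  The index
   [x] is a plain natural number; only x < |s| is meaningful. *)
Inductive ieval (A F : finType) (p : F -> bterm A F) (s : seq A) :
    nat -> iterm A F -> nat -> Prop :=
  | ev_var x : ieval p s x IVar x
  | ev_succ x T v : ieval p s x T v ->
      ieval p s x (ISucc T) (minn v.+1 (size s).-1)
  | ev_pred x T v : ieval p s x T v -> ieval p s x (IPred T) v.-1
  | ev_iif_true x T0 T1 T2 v : beval p s x T0 true -> ieval p s x T1 v ->
      ieval p s x (IIf T0 T1 T2) v
  | ev_iif_false x T0 T1 T2 v : beval p s x T0 false -> ieval p s x T2 v ->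
      ieval p s x (IIf T0 T1 T2) v
with beval (A F : finType) (p : F -> bterm A F) (s : seq A) :
    nat -> bterm A F -> bool -> Prop :=
  | ev_true x : beval p s x BTrue true
  | ev_false x : beval p s x BFalse false
  | ev_call x f T v w : ieval p s x T v -> beval p s v (p f) w ->
      beval p s x (BCall f T) w
  | ev_char x a T v : ieval p s x T v ->
      beval p s x (BChar a T) (onth s v == Some a)
  | ev_max x T v : ieval p s x T v ->
      beval p s x (BMax T) (v == (size s).-1)
  | ev_min x T v : ieval p s x T v -> beval p s x (BMin T) (v == 0)
  | ev_bif_true x T0 T1 T2 w : beval p s x T0 true -> beval p s x T1 w ->
      beval p s x (BIf T0 T1 T2) w
  | ev_bif_false x T0 T1 T2 w : beval p s x T0 false -> beval p s x T2 w ->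
      beval p s x (BIf T0 T1 T2) w.

(* [interp Sg m Ga] is the type of interpretations Sg x m -> Ga: a Ga-BMRS whose
   heads are indexed by Sg x {0, ..., m-1}. *)
Record interp (Sg : finType) (m : nat) (Ga : finType) := Interp {
  fname : finType;
  body : fname -> bterm Ga fname;
  head : Sg -> 'I_m -> bterm Ga fname }.

Section Semantics.
Variables (Sg Ga : finType) (m : nat).
Implicit Types (pi : interp Sg m Ga) (s : seq Ga).

Definition heval pi s (x : nat) (a : Sg) (i : 'I_m) (v : bool) : Prop :=
  beval (@body _ _ _ pi) s x (head pi a i) v.

Definition well_defined pi : Prop :=
  forall s (i : 'I_m) (x : nat), x < size s ->
    (forall a b, heval pi s x a i true -> heval pi s x b i true -> a = b) /\
    (forall b, ~ heval pi s x b i true -> heval pi s x b i false).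

Definition out_symbol pi s (x : nat) (i : 'I_m) : option Sg :=
  [pick a | `[< heval pi s x a i true >]].

(* Total on all interpretations, but meaningful only on well-defined ones. *)
Definition denot pi s : seq Sg :=
  pmap id [seq out_symbol pi s x i | x <- iota 0 (size s), i <- enum 'I_m].

End Semantics.

(* The blank-extended alphabet is [option Sg], the blank being [None]. *)

Definition strictify (Sg Ga : finType) (m : nat) (pi : interp Sg m Ga) :
    interp (option Sg) m Ga :=
  @Interp (option Sg) m Ga (fname pi) (@body _ _ _ pi)
    (fun c i => if c is Some a then head pi a i
       else foldr (fun a T => BIf (head pi a i) BFalse T) BTrue (enum Sg)).

Definition destrictify (Sg Ga : finType) (m : nat)
    (pi : interp (option Sg) m Ga) : interp Sg m Ga :=
  @Interp Sg m Ga (fname pi) (@body _ _ _ pi) (fun a i => head pi (Some a) i).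

Section Rename.
Variables (A F F' : Type) (h : F -> F').

Fixpoint irename (T : iterm A F) : iterm A F' :=
  match T with
  | IVar => IVar
  | ISucc T => ISucc (irename T)
  | IPred T => IPred (irename T)
  | IIf T0 T1 T2 => IIf (brename T0) (irename T1) (irename T2)
  end
with brename (T : bterm A F) : bterm A F' :=
  match T with
  | BTrue => BTrue
  | BFalse => BFalse
  | BCall f T => BCall (h f) (irename T)
  | BChar a T => BChar a (irename T)
  | BMax T => BMax (irename T)
  | BMin T => BMin (irename T)
  | BIf T0 T1 T2 => BIf (brename T0) (brename T1) (brename T2)
  end.

End Rename.

Section StrictComposition.
Variables (De Sg Ga : finType) (m n : nat).
Variables (rho : interp De n Sg) (pi : interp Sg m Ga).

(* The function names are, for each q < m, a copy f_q of every function name f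
   of rho and a function sigma_q for every character sigma, together with the
   function names of pi (shared by all q). *)
Definition scname : finType := ('I_m * (fname rho + Sg) + fname pi)%type.

(* Term of rho read in the q-th copy.  The output of a strict pi on s has m
   letters per index of s, and evaluating rho at its position m * x + q amounts
   to evaluating the q-th copy at the index x of s.  So S steps from the copy q
   to the copy q + 1 at the same index, and from the last copy to the copy 0 at
   the next index; P, max and min are treated accordingly.  (Reading S, P, max
   and min unchanged inside each copy is correct only for m = 1.)
   An index term of rho thus denotes a pair (index term t over s, copy r), which
   depends on conditionals and is passed to the continuation [k]; a step of S
   beyond the end of s stays in place, as does P at its beginning. *)
Fixpoint icopy (q : 'I_m) (T : iterm Sg (fname rho))
    (k : iterm Ga scname -> 'I_m -> bterm Ga scname) : bterm Ga scname :=
  match T with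
  | IVar => k IVar q
  | ISucc T => icopy q T (fun t r =>
      if r.+1 < m then k t (ordS r)
      else BIf (BMax t) (k t r) (k (ISucc t) (ordS r)))
  | IPred T => icopy q T (fun t r =>
      if 0 < r then k t (ord_pred r)
      else BIf (BMin t) (k t r) (k (IPred t) (ord_pred r)))
  | IIf T0 T1 T2 => BIf (bcopy q T0) (icopy q T1 k) (icopy q T2 k)
  end
with bcopy (q : 'I_m) (T : bterm Sg (fname rho)) : bterm Ga scname :=
  match T with
  | BTrue => BTrue
  | BFalse => BFalse
  | BCall f T => icopy q T (fun t r => BCall (inl (r, inl f)) t)
  | BChar a T => icopy q T (fun t r => BCall (inl (r, inr a)) t)
  | BMax T => icopy q T (fun t r => if r.+1 < m then BFalse else BMax t)
  | BMin T => icopy q T (fun t r => if 0 < r then BFalse else BMin t)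
  | BIf T0 T1 T2 => BIf (bcopy q T0) (bcopy q T1) (bcopy q T2)
  end.

Definition scbody (f : scname) : bterm Ga scname :=
  match f with
  | inl (q, inl g) => bcopy q (body g)
  | inl (q, inr a) => brename inr (head pi a q)
  | inr g => brename inr (body g)
  end.

Lemma quot_lt (i : 'I_(m * n)) : i %/ n < m.
Proof.
have n0 : 0 < n by case: n i => [|//]; rewrite muln0 => - [].
by rewrite ltn_divLR.
Qed.

Lemma rem_lt (i : 'I_(m * n)) : i %% n < n.
Proof. by rewrite ltn_mod; case: n i => [|//]; rewrite muln0 => - []. Qed.

Definition scompose : interp De (m * n) Ga :=
  @Interp De (m * n) Ga scname scbody
    (fun d i => bcopy (Ordinal (quot_lt i)) (head rho d (Ordinal (rem_lt i)))).

End StrictComposition.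

Section NormalForm.
Variables (Sg Ga : finType) (m : nat).

Fixpoint normal_term (A F : Type) (T : bterm A F) : bool :=
  match T with
  | BTrue | BFalse => true
  | BCall _ IVar | BCall _ (ISucc IVar) | BCall _ (IPred IVar) => true
  | BChar _ IVar | BMax IVar | BMin IVar => true
  | BIf T0 T1 T2 => [&& normal_term T0, normal_term T1 & normal_term T2]
  | _ => false
  end.

Definition normal (N : interp Sg m Ga) : Prop :=
  (forall f : fname N, normal_term (body f)) /\
  (forall a i, normal_term (head N a i)).

Definition normal_form_of (pi N : interp Sg m Ga) : Prop :=
  normal N /\
  (forall s x a i v, x < size s -> heval pi s x a i v <-> heval N s x a i v).

End NormalForm.

Inductive mode := Star | OnSucc | OnPred.

Inductive aux := MaxC | MaxG | MaxH | MinC | MinG | MinH.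

Definition mode_code (c : mode) : 'I_3 :=
  match c with Star => inord 0 | OnSucc => inord 1 | OnPred => inord 2 end.
Definition mode_decode (i : 'I_3) : mode :=
  match val i with 0 => Star | 1 => OnSucc | _ => OnPred end.
Lemma mode_codeK : cancel mode_code mode_decode.
Proof. by case; rewrite /mode_decode /= inordK. Qed.
HB.instance Definition _ := Finite.copy mode (can_type mode_codeK).

Definition aux_code (c : aux) : 'I_6 :=
  match c with
  | MaxC => inord 0 | MaxG => inord 1 | MaxH => inord 2
  | MinC => inord 3 | MinG => inord 4 | MinH => inord 5
  end.
Definition aux_decode (i : 'I_6) : aux :=
  match val i with
  | 0 => MaxC | 1 => MaxG | 2 => MaxH | 3 => MinC | 4 => MinG | _ => MinH
  end.
Lemma aux_codeK : cancel aux_code aux_decode.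
Proof. by case; rewrite /aux_decode /= inordK. Qed.
HB.instance Definition _ := Finite.copy aux (can_type aux_codeK).

Section BlankEnrichment.
Variables (Sg Ga : finType) (m : nat) (N : interp (option Sg) m Ga).

Definition bename : finType := (mode * fname N + aux)%type.

Local Notation blank := (BChar None IVar).
Local Notation callm c f T := (BCall (inl (c, f)) T).
Local Notation calla g T := (BCall (inr g) T).

(* The last case is reached only by terms that are not in normal form. *)
Fixpoint star (T : bterm Ga (fname N)) : bterm (option Ga) bename :=
  match T with
  | BTrue => BTrue
  | BFalse => BFalse
  | BChar a IVar => BChar (Some a) IVar
  | BMax IVar => calla MaxC IVar
  | BMin IVar => calla MinC IVar
  | BCall f IVar => callm Star f IVar
  | BCall f (ISucc IVar) => callm OnSucc f (ISucc IVar)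
  | BCall f (IPred IVar) => callm OnPred f (IPred IVar)
  | BIf T0 T1 T2 => BIf (star T0) (star T1) (star T2)
  | _ => BFalse
  end.

Definition bebody (f : bename) : bterm (option Ga) bename :=
  match f with
  | inl (Star, f) => star (body f)
  | inl (OnSucc, f) => BIf blank (callm OnSucc f (ISucc IVar)) (star (body f))
  | inl (OnPred, f) => BIf blank (callm OnPred f (IPred IVar)) (star (body f))
  | inr MaxC => BIf blank BFalse (calla MaxG IVar)
  | inr MaxG => BIf (BMax IVar) BTrue (calla MaxH (ISucc IVar))
  | inr MaxH => BIf blank (calla MaxG IVar) BFalse
  | inr MinC => BIf blank BFalse (calla MinG IVar)
  | inr MinG => BIf (BMin IVar) BTrue (calla MinH (IPred IVar))
  | inr MinH => BIf blank (calla MinG IVar) BFalse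
  end.

Definition enrich : interp (option Sg) m (option Ga) :=
  @Interp (option Sg) m (option Ga) bename bebody
    (fun c i => BIf blank (if c is Some _ then BFalse else BTrue)
                  (star (head N c i))).

End BlankEnrichment.

(* The composition of rho and pi, for a choice [N] of a normal form of
   [strictify rho].  It need not be well-defined for every [N]: a call f(S x) of
   [N] at the last letter becomes a call of the OnSucc copy of f, which loops if
   only blanks follow.  This is avoided by the normal forms in which such calls
   are guarded, as in "if max(x) then f(x) else f(S x)". *)
Definition compose (De Sg Ga : finType) (m n : nat)
    (N : interp (option De) n Sg) (pi : interp Sg m Ga) :
    interp De (m * n) Ga :=
  destrictify (scompose (enrich N) (strictify pi)).

(* Main.v *)
(* Evaluation is the least fixpoint of the operator sending an oracle for the
   recursive calls to the semantics of the function bodies, so inclusions between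
   evaluations in two programs follow by exhibiting an oracle closed under that
   operator.  For strict composition, the bodies of the two programs have the
   same semantics under corresponding oracles, index m * x + q of the output of
   pi' being matched with index x in the copy q.  For the blank enrichment,
   position y of w is matched with position [rank w y] of the string u obtained
   by deleting the blanks of w: whatever the enrichment evaluates to, the
   original evaluates to as well, and the converse holds for the programs all of
   whose calls f(S x) and f(P x) are guarded by tests for max and min.  Every
   interpretation has such a guarded normal form, whose functions are the pairs
   of a test and a word of moves still to be performed. *)

Require Import Defs.
From mathcomp Require Import all_boot.
From mathcomp Require Import boolp.
From mathcomp Require Import zify.

Set Implicit Arguments.
Unset Strict Implicit.
Unset Printing Implicit Defensive.

(* Evaluation as a least fixpoint over call oracles *)
Scheme iterm_mut := Induction for iterm Sort Prop
  with bterm_mut := Induction for bterm Sort Prop.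
Combined Scheme term_mut from iterm_mut, bterm_mut.
Scheme ieval_mut := Minimality for ieval Sort Prop
  with beval_mut := Minimality for beval Sort Prop.
Combined Scheme eval_mut from ieval_mut, beval_mut.

Section Oracle.
Variables (A F : finType) (s : seq A).
Implicit Types (p : F -> bterm A F) (x v : nat) (b : bool).

Section Semantics.
Variable R : F -> nat -> bool -> Prop.

(* The calls are answered by the oracle [R]. *)
Fixpoint isem x (T : iterm A F) v : Prop :=
  match T with
  | IVar => v = x
  | ISucc T => exists2 u, isem x T u & v = minn u.+1 (size s).-1
  | IPred T => exists2 u, isem x T u & v = u.-1
  | IIf T0 T1 T2 => bsem x T0 true /\ isem x T1 v \/ bsem x T0 false /\ isem x T2 v
  end
with bsem x (T : bterm A F) b : Prop :=
  match T with
  | BTrue => b = true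
  | BFalse => b = false
  | BCall f T => exists2 v, isem x T v & R f v b
  | BChar a T => exists2 v, isem x T v & b = (onth s v == Some a)
  | BMax T => exists2 v, isem x T v & b = (v == (size s).-1)
  | BMin T => exists2 v, isem x T v & b = (v == 0)
  | BIf T0 T1 T2 => bsem x T0 true /\ bsem x T1 b \/ bsem x T0 false /\ bsem x T2 b
  end.

Lemma isem_lt x (T : iterm A F) v : x < size s -> isem x T v -> v < size s.
Proof.
move=> xs; elim: T v => /= [v ->|T IH v [u /IH]|T IH v [u /IH]|T0 T1 IH1 T2 IH2 v] //.
- lia.
- lia.
- by case=> -[_]; [apply: IH1|apply: IH2].
Qed.

End Semantics.

Definition callsem p f x b := beval p s x (p f) b.

Lemma eval_sem p x :
  (forall T v, isem (callsem p) x T v -> ieval p s x T v) /\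
  (forall T b, bsem (callsem p) x T b -> beval p s x T b).
Proof.
apply: term_mut => /=.
- by move=> v ->; constructor.
- by move=> T IH v [u /IH ? ->]; constructor.
- by move=> T IH v [u /IH ? ->]; constructor.
- move=> T0 IH0 T1 IH1 T2 IH2 v [[/IH0 ? /IH1 ?]|[/IH0 ? /IH2 ?]].
    exact: ev_iif_true.
  exact: ev_iif_false.
- by move=> b ->; constructor.
- by move=> b ->; constructor.
- by move=> f T IH b [v /IH ? ?]; apply: ev_call; eassumption.
- by move=> a T IH b [v /IH ? ->]; constructor.
- by move=> T IH b [v /IH ? ->]; constructor.
- by move=> T IH b [v /IH ? ->]; constructor.
- move=> T0 IH0 T1 IH1 T2 IH2 v [[/IH0 ? /IH1 ?]|[/IH0 ? /IH2 ?]].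
    exact: ev_bif_true.
  exact: ev_bif_false.
Qed.

(** Induction on derivations: only a call leaves the term, and the closure of [R] absorbs it.
    Closure at positions below [size s] suffices because S and P never leave the string. *)
Lemma sem_eval p R :
  (forall f x b, x < size s -> bsem R x (p f) b -> R f x b) ->
  (forall x T v, ieval p s x T v -> x < size s -> isem R x T v) /\
  (forall x T b, beval p s x T b -> x < size s -> bsem R x T b).
Proof.
move=> clR.
apply: (@eval_mut A F p s (fun x T v => x < size s -> isem R x T v)
                          (fun x T b => x < size s -> bsem R x T b)) => //=.
- by move=> x T v _ IH /IH; exists v.
- by move=> x T v _ IH /IH; exists v.
- by move=> x T0 T1 T2 v _ IH0 _ IH1 xs; left; split; auto.
- by move=> x T0 T1 T2 v _ IH0 _ IH1 xs; right; split; auto.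
- move=> x f T v w _ IH _ IHf xs; exists v; first exact: IH.
  by have vs := isem_lt xs (IH xs); apply: clR => //; apply: IHf.
- by move=> x a T v _ IH /IH; exists v.
- by move=> x T v _ IH /IH; exists v.
- by move=> x T v _ IH /IH; exists v.
- by move=> x T0 T1 T2 v _ IH0 _ IH1 xs; left; split; auto.
- by move=> x T0 T1 T2 v _ IH0 _ IH1 xs; right; split; auto.
Qed.

Lemma bsem_beval p x T b : bsem (callsem p) x T b -> beval p s x T b.
Proof. exact: (eval_sem p x).2. Qed.

Lemma beval_bsem p R x T b :
  (forall f x b, x < size s -> bsem R x (p f) b -> R f x b) ->
  x < size s -> beval p s x T b -> bsem R x T b.
Proof. by move=> /sem_eval[_ H] xs /H; apply. Qed.

Lemma bevalE p x T b : x < size s -> beval p s x T b <-> bsem (callsem p) x T b.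
Proof.
move=> xs; split; last exact: bsem_beval.
by apply: beval_bsem => // f y c ys; exact: bsem_beval.
Qed.

Lemma sem_sub (R1 R2 : F -> nat -> bool -> Prop) x :
  (forall f v b, R1 f v b -> R2 f v b) ->
  (forall T v, isem R1 x T v -> isem R2 x T v) /\
  (forall T b, bsem R1 x T b -> bsem R2 x T b).
Proof.
move=> HR; apply: term_mut => //= [T IH v|T IH v|T0 IH0 T1 IH1 T2 IH2 v|f T IH b
  |a T IH b|T IH b|T IH b|T0 IH0 T1 IH1 T2 IH2 b].
all: try by case=> [v0 /IH ? ?]; exists v0; auto.
all: by case=> -[/IH0 ? H]; [left|right]; auto.
Qed.

Lemma bsem_sub (R1 R2 : F -> nat -> bool -> Prop) x T b :
  (forall f v b, R1 f v b -> R2 f v b) -> bsem R1 x T b -> bsem R2 x T b.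
Proof. by move=> /(@sem_sub _ _ x)[_]; apply. Qed.

Lemma sem_det R1 R2 x :
  (forall f v b c, R1 f v b -> R2 f v c -> b = c) ->
  (forall T v u, isem R1 x T v -> isem R2 x T u -> v = u) /\
  (forall T b c, bsem R1 x T b -> bsem R2 x T c -> b = c).
Proof.
move=> HR; apply: term_mut => /=.
- by move=> v u -> ->.
- by move=> T IH v u [v' h ->] [u' h' ->]; rewrite (IH _ _ h h').
- by move=> T IH v u [v' h ->] [u' h' ->]; rewrite (IH _ _ h h').
- by move=> T0 IH0 T1 IH1 T2 IH2 v u [] [h0 h] [] [h0' h'];
    [exact: IH1| |  |exact: IH2]; have := IH0 _ _ h0 h0'.
- by move=> b c -> ->.
- by move=> b c -> ->.
- by move=> f T IH b c [v h r] [u /(IH _ _ h) <-]; exact: HR.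
- by move=> a T IH b c [v h ->] [u /(IH _ _ h) <-].
- by move=> T IH b c [v h ->] [u /(IH _ _ h) <-].
- by move=> T IH b c [v h ->] [u /(IH _ _ h) <-].
- by move=> T0 IH0 T1 IH1 T2 IH2 v u [] [h0 h] [] [h0' h'];
    [exact: IH1| |  |exact: IH2]; have := IH0 _ _ h0 h0'.
Qed.

Lemma beval_det p x T b c :
  x < size s -> beval p s x T b -> beval p s x T c -> b = c.
Proof.
(* [R] holds of [b] when no evaluation of the call gives another value. By [det] this oracle is
   closed, so every derived value lies in it. *)
move=> xs; pose R f v b := forall c, callsem p f v c -> b = c.
have det y T0 b0 c0 : y < size s -> bsem R y T0 b0 -> beval p s y T0 c0 -> b0 = c0.
  by move=> ys h /(bevalE _ _ _ ys); apply: (@sem_det R _ y _).2 h => f v b1 c1; apply.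
move=> h h'; apply: (det) h' => //; apply: beval_bsem h => // f y b0 ys h0 c0.
exact: det.
Qed.

End Oracle.

(** * Invariance under renaming of functions *)

Section Renaming.
Variables (A F F' : finType) (s : seq A) (h : F -> F').

Lemma sem_rename R x :
  (forall T v, isem s R x (irename h T) v <-> isem s (R \o h) x T v) /\
  (forall T b, bsem s R x (brename h T) b <-> bsem s (R \o h) x T b).
Proof.
apply: term_mut => //= [T IH v|T IH v|T0 IH0 T1 IH1 T2 IH2 v|f T IH b|a T IH b
  |T IH b|T IH b|T0 IH0 T1 IH1 T2 IH2 b].
all: try by split=> -[v0 /IH ? ?]; exists v0.
all: by rewrite ?IH0 ?IH1 ?IH2.
Qed.

Lemma bsem_rename R x T b : bsem s R x (brename h T) b <-> bsem s (R \o h) x T b.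
Proof. exact: (sem_rename R x).2. Qed.

Lemma beval_rename p p' x T b :
  (forall f, p' (h f) = brename h (p f)) -> x < size s ->
  beval p' s x (brename h T) b <-> beval p s x T b.
Proof.
move=> p'h xs; split=> [H|].
  (* Names outside the image of [h] are left unconstrained, and quantifying over all preimages
     avoids assuming [h] injective. *)
  pose R g y c := forall f, g = h f -> callsem s p f y c.
  have sub y T' c : bsem s (R \o h) y T' c -> beval p s y T' c.
    by move=> H'; apply: bsem_beval; apply: bsem_sub H' => f z d; apply.
  apply: (sub); apply/bsem_rename; apply: beval_bsem H => //.
  by move=> g y c ys H f gE; move: H; rewrite gE p'h => /bsem_rename; apply: sub.
move=> /(@beval_bsem _ _ _ p (callsem s p' \o h)) H; apply: bsem_beval.
apply/bsem_rename/H => // f y c ys /bsem_rename.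
by rewrite -p'h => /bsem_beval.
Qed.
End Renaming.

(** * Strict composition: index [v] in copy [r] stands for position [v * m + r] *)

Section Copy.
Variables (De Sg Ga : finType) (m n : nat).
Variables (rho : interp De n Sg) (pi : interp Sg m Ga).
Variables (s : seq Ga) (w : seq Sg).
Hypothesis size_w : size w = size s * m.

Section Term.
Variables (R : fname rho -> nat -> bool -> Prop).
Variables (R' : scname rho pi -> nat -> bool -> Prop).
Hypothesis R'_fun : forall r f v b, v < size s ->
  R' (inl (r, inl f)) v b <-> R f (v * m + r) b.
Hypothesis R'_char : forall (r : 'I_m) a v b, v < size s ->
  R' (inl (r, inr a)) v b <-> b = (onth w (v * m + r) == Some a).

(** Invariant of the continuation-passing translation: [Q] is what the continuation says about a
    position of [w], and it has to be right only for pairs [(t, r)] where [t] denotes exactly one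
    index. *)
Lemma sem_copy x : x < size s ->
  (forall T (q : 'I_m) k b (Q : nat -> Prop),
     (forall t (r : 'I_m) v, v < size s ->
        (forall u, isem s R' x t u <-> u = v) ->
        bsem s R' x (k t r) b <-> Q (v * m + r)) ->
     bsem s R' x (icopy q T k) b <-> exists2 y, isem w R (x * m + q) T y & Q y) /\
  (forall T (q : 'I_m) b,
     bsem s R' x (bcopy pi q T) b <-> bsem w R (x * m + q) T b).
Proof.
move=> xs.
have var u : isem s R' x IVar u <-> u = x by [].
have ex1 (t : iterm Ga (scname rho pi)) v (P : nat -> Prop) :
    (forall u, isem s R' x t u <-> u = v) ->
    ex2 (isem s R' x t) P <-> P v.
  by move=> tv; split=> [[u /tv ->]|Pv] //; exists v => //; apply/tv.
apply: term_mut => /=.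
- move=> q k b Q kQ; rewrite (kQ _ _ _ xs var).
  by split=> [|[y ->]] //; exists (x * m + q).
- move=> T IH q k b Q kQ.
  rewrite (IH _ _ _ (fun y => Q (minn y.+1 (size w).-1))) => [|t r v vs tv].
    split=> [[y yT Qy]|[y [u uT ->] Qu]]; last by exists u.
    by exists (minn y.+1 (size w).-1) => //; exists y.
  have rm := ltn_ord r; have lt_w: v * m + m <= size w.
    by rewrite size_w -mulSnr leq_mul2r vs orbT.
  case: ifP => [r1m|/negbT r1m].
    rewrite (kQ _ _ _ vs tv) /= modn_small //.
    by rewrite (_ : minn _ _ = v * m + r.+1) //; lia.
  (* From the last copy, S wraps to copy 0 of the next index, unless [v] is the last index, where
     both sides stay in place. *)
  have r0 : ordS r = 0 :> nat by rewrite /= (_ : r.+1 = m) ?modnn //; lia.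
  rewrite /= !(ex1 _ _ _ tv); case: eqVneq => [vE|vN].
    rewrite (kQ _ _ _ vs tv) (_ : minn _ _ = v * m + r).
      by split=> [[[]|[]]|] //; left.
    have: size w = v * m + m by rewrite size_w -mulSnr vE; congr (_ * _); lia.
    by lia.
  rewrite (kQ (ISucc t) _ v.+1) ?r0; first last.
  - move=> u; rewrite /= (ex1 _ _ _ tv); lia.
  - lia.
  rewrite (_ : minn _ _ = v.+1 * m + 0); first by split=> [[[]|[]]|] //; right.
  (* As [v] is not the last index, a whole further block fits in [w], and the [minn] does not
     truncate. *)
  have: v.+2 * m <= size w by rewrite size_w leq_mul2r; apply/orP; right; lia.
  rewrite !mulSnr; lia.
- move=> T IH q k b Q kQ.
  rewrite (IH _ _ _ (fun y => Q y.-1)) => [|t r v vs tv].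
    split=> [[y yT Qy]|[y [u uT ->] Qu]]; last by exists u.
    by exists y.-1 => //; exists y.
  have rm := ltn_ord r.
  case: ifP => [r_gt0|/negbT r0].
    rewrite (kQ _ _ _ vs tv) /=.
    rewrite (_ : (r + m).-1 = r.-1 + m) ?modnDr ?modn_small; try lia.
    by rewrite (_ : (v * m + r).-1 = v * m + r.-1) //; lia.
  have {}r0 : r = 0 :> nat by lia.
  have r1 : ord_pred r = m.-1 :> nat by rewrite /= r0 modn_small //; lia.
  rewrite /= !(ex1 _ _ _ tv); case: eqVneq => [vE|vN].
    by rewrite (kQ _ _ _ vs tv) vE r0; split=> [[[]|[]]|] //; left.
  rewrite (kQ (IPred t) _ v.-1) ?r1; first last.
  - by move=> u; rewrite /= (ex1 _ _ _ tv).
  - lia.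
  rewrite (_ : (_ + r).-1 = v.-1 * m + m.-1).
    by split=> [[[]|[]]|] //; right.
  case: v vN {vs tv} => // v _; rewrite mulSnr; lia.
- move=> T0 IH0 T1 IH1 T2 IH2 q k b Q kQ; rewrite !IH0 (IH1 _ _ _ Q) // (IH2 _ _ _ Q) //.
  split=> [[[h0 [y h Qy]]|[h0 [y h Qy]]]|[y [[h0 h]|[h0 h]] Qy]].
  + by exists y; first left.
  + by exists y; first right.
  + by left; split=> //; exists y.
  + by right; split=> //; exists y.
- by [].
- by [].
- move=> f T IH q b; apply: IH => t r v vs tv /=.
  by rewrite (ex1 _ _ _ tv) R'_fun.
- move=> a T IH q b; apply: IH => t r v vs tv /=.
  by rewrite (ex1 _ _ _ tv) R'_char.
- move=> T IH q b; apply: IH => t r v vs tv.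
  have rm := ltn_ord r; have lt_w: v * m + m <= size w.
    by rewrite size_w -mulSnr leq_mul2r vs orbT.
  (* Position [v * m + r] is last in [w] exactly when [r] is the last copy and [v] the last
     index. *)
  case: ifP => [r1m|/negbT r1m].
    by rewrite (_ : (_ == _) = false) //; lia.
  rewrite /= (ex1 _ _ _ tv) (_ : (_ == (size w).-1) = (v == (size s).-1)) //.
  rewrite size_w in lt_w *; apply/eqP; case: eqVneq => [vE|vN].
    have: size s * m = v * m + m by rewrite -mulSnr vE; congr (_ * _); lia.
    by lia.
  have: v.+2 * m <= size s * m by rewrite leq_mul2r; apply/orP; right; lia.
  rewrite !mulSnr; lia.
- move=> T IH q b; apply: IH => t r v vs tv.
  case: ifP => [r_gt0|/negbT r0].
    by rewrite (_ : (_ == _) = false) //; lia.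
  rewrite /= (ex1 _ _ _ tv) (_ : (_ == 0) = (v == 0)) //.
  rewrite addn_eq0 muln_eq0; have := ltn_ord r; lia.
- by move=> T0 IH0 T1 IH1 T2 IH2 q b; rewrite !IH0 IH1 IH2.
Qed.

End Term.

Hypothesis pi_w : forall x a (r : 'I_m) b, x < size s ->
  heval pi s x a r b <-> b = (onth w (x * m + r) == Some a).

Lemma heval_scompose x d (i : 'I_(m * n)) b : x < size s ->
  heval (scompose rho pi) s x d i b <->
  heval rho w (x * m + i %/ n) d (Ordinal (rem_lt i)) b.
Proof.
move=> xs; rewrite /heval /=.
set q := Ordinal (quot_lt i); set T := Defs.head rho d _.
have lt_w y (r : 'I_m) : y < size s -> y * m + r < size w.
  move=> ys; apply: (@leq_trans (y.+1 * m)); first by rewrite mulSnr ltn_add2l.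
  by rewrite size_w leq_mul2r ys orbT.
have pi_copy y a (r : 'I_m) c : y < size s ->
    beval (scbody (rho := rho) (pi := pi)) s y (brename inr (Defs.head pi a r)) c <->
    c = (onth w (y * m + r) == Some a).
  by move=> ys; rewrite (beval_rename (p := body (i := pi))) //; apply: pi_w.
split=> H.
(* Soundness: a copied function is read at the matching position of [w], a copied character tests
   [w] itself, and the names of [pi] keep their own evaluation. *)
- pose R' (g : scname rho pi) y c := match g with
    | inl (r, inl f) => callsem w (body (i := rho)) f (y * m + r) c
    | inl (r, inr a) => c = (onth w (y * m + r) == Some a)
    | inr g => callsem s (scbody (rho := rho) (pi := pi)) (inr g : scname rho pi) y c end.
  have copy y (T' : bterm Sg (fname rho)) (r : 'I_m) c : y < size s ->
      bsem s R' y (bcopy pi r T') c <->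
      bsem w (callsem w (body (i := rho))) (y * m + r) T' c.
    by move=> ys; apply: (sem_copy _ _ ys).2.
  apply/bsem_beval/(copy x T q) => //; apply: beval_bsem H => // g y c ys.
  case: g => [[r [f|a]]|g] /=.
  + by move=> /(copy _ _ _ _ ys) H; apply: bsem_beval.
  + by move=> /bsem_rename H; apply/pi_copy => //; apply/bsem_beval/bsem_rename.
  + by move=> /bsem_rename H; apply/bsem_beval/bsem_rename.
(* Completeness: the oracle on [w] sends a call back to every pair [(v, r)] with [y = v * m + r];
   [RP] shows by Euclidean division that there is only one. *)
- pose R f y c := forall v (r : 'I_m), v < size s -> y = v * m + r ->
    callsem s (scbody (rho := rho) (pi := pi)) (inl (r, inl f) : scname rho pi) v c.
  have RP r f v c : v < size s ->
      callsem s (scbody (rho := rho) (pi := pi)) (inl (r, inl f) : scname rho pi) v c <->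
      R f (v * m + r) c.
    move=> vs; split=> [H' u r' us|]; last exact.
    have m0 : 0 < m by exact: leq_ltn_trans (leq0n r) (ltn_ord r).
    move=> e; have := congr1 (divn^~ m) e; have := congr1 (modn^~ m) e.
    rewrite !modnMDl !modn_small // !divnMDl // !divn_small // !addn0.
    by move=> /val_inj <- <-.
  have copy y (T' : bterm Sg (fname rho)) (r : 'I_m) c : y < size s ->
      bsem s (callsem s (scbody (rho := rho) (pi := pi))) y (bcopy pi r T') c <->
      bsem w R (y * m + r) T' c.
    by move=> ys; apply: (sem_copy RP _ ys).2 => r' a v b' vs; apply: pi_copy.
  apply/bsem_beval/(copy x T q) => //; apply: beval_bsem H; last exact: (lt_w x q).
  by move=> f y c yw H v r vs yE; apply/bsem_beval/copy; rewrite -?yE.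
Qed.

End Copy.

(** * Positions after the deletion of blanks *)

Definition rank (A : Type) (w : seq (option A)) y := count isSome (take y w).

Section Rank.
Variables (A : Type) (w : seq (option A)).
Local Notation nonblank y := (isSome (nth None w y)).

Lemma rank0 : rank w 0 = 0.
Proof. by rewrite /rank take0. Qed.

Lemma rankS y : y < size w -> rank w y.+1 = rank w y + nonblank y.
Proof. by move=> yw; rewrite /rank (take_nth None) // -cats1 count_cat /= addn0. Qed.

Lemma rank_size : rank w (size w) = size (pmap id w).
Proof. by rewrite /rank take_size size_pmap. Qed.

Lemma rank_le y : rank w y <= size (pmap id w).
Proof. by rewrite size_pmap -[in leqRHS](cat_take_drop y w) count_cat leq_addr. Qed.

Lemma rank_lt y : nonblank y -> rank w y < size (pmap id w).
Proof.
move=> ny; have yw : y < size w by case: ltnP ny => // /(nth_default None) ->.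
by have := rank_le y.+1; rewrite rankS // ny addn1.
Qed.

End Rank.

Lemma onth_rank (A : Type) (w : seq (option A)) y :
  nth None w y -> onth (pmap id w) (rank w y) = nth None w y.
Proof. by elim: w y => [|[a|] w IH] [|y] //=; apply: IH. Qed.

Lemma onth_eq (T : eqType) (x0 : T) (s : seq T) y c :
  y < size s -> (onth s y == Some c) = (nth x0 s y == c).
Proof. by move=> ys; rewrite onthE (nth_map x0). Qed.

(** * Blank enrichment: soundness, then termination for guarded programs *)

Section Enrich.
Variables (Sg Ga : finType) (m : nat) (N : interp (option Sg) m Ga).
Variable (w : seq (option Ga)).
Local Notation u := (pmap id w).
Local Notation rank := (rank w).
Local Notation nonblank y := (isSome (nth None w y)).
Implicit Types (y : nat) (b : bool) (T : bterm Ga (fname N)).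

Lemma onth_letter y (a : Ga) : nonblank y -> y < size w ->
  (onth w y == Some (Some a)) = (onth u (rank y) == Some a).
Proof. by move=> ny yw; rewrite (onth_eq None) // onth_rank //; case: (nth None w y) ny. Qed.

Lemma onth_blank y : y < size w -> (onth w y == Some None) = ~~ nonblank y.
Proof. by move=> yw; rewrite (onth_eq None) //; case: (nth None w y). Qed.

(* A call f^S at y reads f at the next letter, whose position is [rank y].
   The call f^S(S x) at the last letter stays at that letter if it is the last
   symbol of [w], and loops otherwise; hence the condition [rank y < size u]. *)
Definition enrich_oracle (R : fname N -> nat -> bool -> Prop) (g : bename N) y b :=
  match g with
  | inl (Star, f) => nonblank y -> R f (rank y) b
  | inl (OnSucc, f) => rank y < size u /\ R f (rank y) b
  | inl (OnPred, f) => 0 < rank y.+1 /\ R f (rank y.+1).-1 b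
  | inr MaxC => nonblank y -> b = (rank y == (size u).-1)
  | inr MaxG => b = (rank y.+1 == size u)
  | inr MaxH => b = (rank y == size u)
  | inr MinC => nonblank y -> b = (rank y == 0)
  | inr MinG => b = (rank y == 0)
  | inr MinH => b = (rank y.+1 == 0)
  end.

(** Passing the letter at [y] raises the rank by one, so the first letter after [y] sits at
    [(rank y).+1] of [u] and the last one before it at [(rank y).-1]. *)
Lemma sem_star R T y b : normal_term T -> nonblank y -> y < size w ->
  bsem w (enrich_oracle R) y (star T) b -> bsem u R (rank y) T b.
Proof.
move=> + ny yw; have ry := rank_lt ny; have rSy := rankS yw.
rewrite ny addn1 in rSy.
elim: T b => //= [f [|[]|[]|] //|a [] //|[] //|[] //|T0 IH0 T1 IH1 T2 IH2] b.
- by move=> _ [_ -> H]; exists (rank y) => //; apply: H.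
- move=> _ [_ [_ -> ->] [r_lt H]]; exists (minn (rank y).+1 (size u).-1); first by exists (rank y).
  (* Before the end of [w], the rank condition of the oracle excludes truncation in [u]; at the end,
     S stays in place in both strings. *)
  congr (R _ _ _): H; case: (ltnP y.+1 (size w)) => yw'.
    move: r_lt; have -> : minn y.+1 (size w).-1 = y.+1 by lia.
    by lia.
  have wE : size w = y.+1 by lia.
  have -> : minn y.+1 (size w).-1 = y by lia.
  by have := rank_size w; rewrite wE; lia.
- move=> _ [_ [_ -> ->] [_ H]]; exists (rank y).-1; first by exists (rank y).
  congr (R _ _ _): H; case: (y) (rSy) ny yw => [|y'] //=.
  by rewrite rank0 => ->.
- by move=> _ [_ -> ->]; exists (rank y) => //; rewrite onth_letter.
- by move=> _ [_ -> H]; exists (rank y) => //; apply: H.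
- by move=> _ [_ -> H]; exists (rank y) => //; apply: H.
- case/and3P=> n0 n1 n2 [[/(IH0 _ n0) h0 /(IH1 _ n1) h1]|[/(IH0 _ n0) h0 /(IH2 _ n2) h2]].
    by left.
  by right.
Qed.

(** The oracle built from the evaluation of [N] is closed under the bodies of the enrichment, hence
    contains all their values. Termination is not claimed: a looping call has no value to check. *)
Lemma heval_enrich_sound y c i b : normal N -> y < size w ->
  heval (enrich N) w y c i b ->
  if nth None w y is Some _ then heval N u (rank y) c i b else b = (c == None).
Proof.
move=> [nB nH] yw H; pose R := callsem u (body (i := N)).
have star_sound z T d : normal_term T -> nonblank z -> z < size w ->
    bsem w (enrich_oracle R) z (star T) d -> beval (body (i := N)) u (rank z) T d.
  by move=> nT nz zw /(sem_star nT nz zw) /bsem_beval.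
have {H} : bsem w (enrich_oracle R) y (Defs.head (enrich N) c i) b.
  apply: beval_bsem H => // g z d /= zw; have rSz := rankS zw.
  have rz := @rank_lt _ w z; have rz' := rank_le w z.+1.
  case: g => [[[] f]|[]] /=.
  - by move=> /star_sound-H nz; apply: H.
  - case=> -[[_ -> /esym]]; rewrite onth_blank //.
      move=> bz [_ [_ -> ->] [r1 r2]].
      (* Skipping a blank leaves the rank unchanged, also when S stays at the end of [w]. *)
      rewrite (_ : rank z = rank (minn z.+1 (size w).-1)); first by split.
      have rE : rank z.+1 = rank z by rewrite rSz (negbTE bz) addn0.
      case: (ltnP z.+1 (size w)) => zw'; last by congr (rank _); lia.
      by rewrite -rE; congr (rank _); lia.
    move=> /negbFE nz /star_sound-H; split; first exact: rz.
    exact: H.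
  - case=> -[[_ -> /esym]]; rewrite onth_blank //.
      move=> bz [_ [_ -> ->] [r1 r2]].
      (* For P the relevant count includes the current position; it does not change when a blank [z]
         is left for [z.-1]. *)
      rewrite (_ : rank z.+1 = rank z.-1.+1); first by split.
      by case: (z) bz rSz => [|z'] //= bz ->; rewrite (negbTE bz) addn0.
    move=> /negbFE nz /star_sound-H; rewrite rSz nz addn1; split=> //.
    exact: H.
  - case=> -[[_ -> /esym]]; rewrite onth_blank //; first by move=> bz _; rewrite (negbTE bz).
    by move=> /negbFE nz [_ -> ->] _; have := rz nz; rewrite rSz nz; lia.
  - case=> -[[_ -> /esym]] => [/eqP e ->|/negbT e [_ [_ -> ->] ->]].
      have wE : size w = z.+1 by lia.
      by have := rank_size w; rewrite wE => ->; rewrite eqxx.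
    by congr (rank _ == _); lia.
  - case=> -[[_ -> /esym]]; rewrite onth_blank //.
      by move=> bz [_ -> ->]; rewrite rSz (negbTE bz) addn0.
    by move=> /negbFE nz ->; have := rz nz; lia.
  - case=> -[[_ -> /esym]]; rewrite onth_blank //; first by move=> bz _; rewrite (negbTE bz).
    by move=> /negbFE nz [_ -> ->] _.
  - case=> -[[_ -> /esym]] => [/eqP -> ->|/negbT e [_ [_ -> ->] ->]].
      by rewrite rank0.
    by rewrite prednK // lt0n.
  - case=> -[[_ -> /esym]]; rewrite onth_blank //.
      by move=> bz [_ -> ->]; rewrite rSz (negbTE bz) addn0.
    by move=> /negbFE nz ->; rewrite rSz nz addn1.
move=> /= [[[_ -> /esym]]|[[_ -> /esym]]]; rewrite onth_blank //.
  by case: (nth None w y) => //= _; case: c => //= ? ->.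
move=> /negbFE nz /star_sound-H; case e: (nth None w y) nz => [a|] // _.
by apply: H; rewrite ?e.
Qed.

Fixpoint local_term (A F : Type) (T : bterm A F) : bool :=
  match T with
  | BTrue | BFalse => true
  | BCall _ IVar | BChar _ IVar | BMax IVar | BMin IVar => true
  | BIf T0 T1 T2 => [&& local_term T0, local_term T1 & local_term T2]
  | _ => false
  end.

(* A sufficient condition for the blank enrichment of a term to terminate
   whenever the term does. *)
Variant guarded (A F : Type) : bterm A F -> Prop :=
  | guarded_local (T : bterm A F) of local_term T : guarded T
  | guarded_succ f : guarded (BIf (BMax IVar) (BCall f IVar) (BCall f (ISucc IVar)))
  | guarded_pred f : guarded (BIf (BMin IVar) (BCall f IVar) (BCall f (IPred IVar))).

Local Notation L := (callsem w (bebody (N := N))).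

(** Induction on the distance to the end of [w]: the search skips blanks and stops at the first
    letter or at the end. *)
Lemma maxG_total y : y < size w -> L (inr MaxG) y (rank y.+1 == size u).
Proof.
move=> yw; have [k] := ubnP (size w - y); elim: k y yw => // k IH y yw le_k.
apply: bsem_beval => /=; have [yE|yN] := eqVneq y (size w).-1.
  left; split; first by exists y; rewrite // yE eqxx.
  by rewrite (_ : y.+1 = size w) ?rank_size ?eqxx //; lia.
have Syw : y.+1 < size w by lia.
right; split; first by exists y; rewrite // (negbTE yN).
exists y.+1; first by exists y => //; rewrite (minn_idPl _) //; lia.
apply: bsem_beval => /=; case: (boolP (nonblank y.+1)) => ny.
  right; split; first by exists y.+1; rewrite // onth_blank // ny.
  by have := rank_lt ny; lia.
left; split; first by exists y.+1; rewrite // onth_blank // ny.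
(* The blank at [y.+1] does not raise the rank, so the goal becomes the value of [MaxG] at
   [y.+1]. *)
exists y.+1 => //; rewrite -[rank y.+1]addn0 -[0]/(nat_of_bool false) -(negbTE ny) -rankS //.
by apply: IH => //; lia.
Qed.

Lemma minG_total y : y < size w -> L (inr MinG) y (rank y == 0).
Proof.
elim: y => [|y IH] yw; apply: bsem_beval => /=.
  by left; split; [exists 0|rewrite rank0].
right; split; first by exists y.+1.
exists y; first by exists y.+1.
apply: bsem_beval => /=; rewrite rankS; last lia; case: (boolP (nonblank y)) => ny.
  right; split; last by rewrite addn1.
  by exists y; rewrite // onth_blank ?ny //; lia.
left; split; first by exists y; rewrite // onth_blank ?ny //; lia.
by exists y => //; rewrite addn0; apply: IH; lia.
Qed.

(** Oracle on [u] for the converse inclusion; quantifying over every letter of rank [z] avoids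
    choosing one. *)
Definition star_oracle f z b := forall y, y < size w -> nonblank y -> rank y = z ->
  beval (bebody (N := N)) w y (star (body f)) b.

(** The hypothesis [rank y < size u] says that a letter remains at or after [y], so the skipping
    ends there. *)
Lemma onsucc_total f y b : y < size w -> rank y < size u ->
  star_oracle f (rank y) b -> L (inl (OnSucc, f)) y b.
Proof.
move=> yw; have [k] := ubnP (size w - y); elim: k y yw => // k IH y yw le_k ry fy.
apply: bsem_beval => /=; case: (boolP (nonblank y)) => ny.
  right; split; first by exists y; rewrite // onth_blank // ny.
  by rewrite -bevalE //; apply: fy.
left; split; first by exists y; rewrite // onth_blank // ny.
have rSy : rank y.+1 = rank y by rewrite rankS // (negbTE ny) addn0.
(* A blank at the last index would give [rank y = size u]. *)
have Syw : y.+1 < size w.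
  case: (ltnP y.+1 (size w)) => // h.
  by have := rank_size w; rewrite (_ : size w = y.+1); lia.
exists y.+1; first by exists y => //; rewrite (minn_idPl _) //; lia.
by apply: IH => //; rewrite ?rSy //; lia.
Qed.

Lemma onpred_total f y b : y < size w -> 0 < rank y.+1 ->
  star_oracle f (rank y.+1).-1 b -> L (inl (OnPred, f)) y b.
Proof.
elim: y => [|y IH] yw ry fy; apply: bsem_beval => /=.
  move: ry fy; rewrite rankS // rank0; case: (boolP (nonblank 0)) => // n0 _ f0.
  right; split; first by exists 0; rewrite // onth_blank // n0.
  by rewrite -bevalE //; apply: f0; rewrite ?rank0.
move: ry fy; rewrite rankS //; case: (boolP (nonblank y.+1)) => ny ry fy.
  right; split; first by exists y.+1; rewrite // onth_blank // ny.
  by rewrite -bevalE //; apply: fy => //; lia.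
left; split; first by exists y.+1; rewrite // onth_blank // ny.
exists y; first by exists y.+1.
by move: ry fy; rewrite addn0 => ry fy; apply: IH => //; lia.
Qed.

Lemma local_star T y b : local_term T -> nonblank y -> y < size w ->
  bsem u star_oracle (rank y) T b -> beval (bebody (N := N)) w y (star T) b.
Proof.
move=> + ny yw; have ry := rank_lt ny; have rSy := rankS yw.
have blankF : isem w L y IVar y /\ false = (onth w y == Some None).
  by rewrite onth_blank // ny.
have bl : bsem w L y (BChar None IVar) false by exists y; case: blankF.
elim: T b => //= [b _ ->|b _ ->|f [] // b _ [_ ->]|a [] // b _ [_ -> ->]
  |[] // b _ [_ -> ->]|[] // b _ [_ -> ->]|T0 IH0 T1 IH1 T2 IH2 b].
- exact: ev_true.
- exact: ev_false.
- by move=> fy; apply: bsem_beval; exists y => //; apply: fy.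
- by rewrite -onth_letter //; apply: bsem_beval; exists y.
- rewrite (_ : (_ == _) = (rank y.+1 == size u)); last by rewrite rSy ny; lia.
  apply: bsem_beval; exists y => //; apply: bsem_beval; right; split=> //.
  by exists y => //; apply: maxG_total.
- apply: bsem_beval; exists y => //; apply: bsem_beval; right; split=> //.
  by exists y => //; apply: minG_total.
case/and3P=> n0 n1 n2 [[/(IH0 _ n0) h0 /(IH1 _ n1) h1]|[/(IH0 _ n0) h0 /(IH2 _ n2) h2]].
  exact: ev_bif_true.
exact: ev_bif_false.
Qed.

(** Once the guard on max has failed, a letter follows [y] and [onsucc_total] applies; likewise for
    P with min. This is what excludes the loop on trailing blanks. *)
Lemma guarded_star T y b : guarded T -> nonblank y -> y < size w ->
  bsem u star_oracle (rank y) T b -> beval (bebody (N := N)) w y (star T) b.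
Proof.
move=> [T' lT|f|f] ny yw; first exact: local_star.
- have ry := rank_lt ny; have rSy := rankS yw; rewrite ny addn1 in rSy.
  case=> -[h0 h1]; [apply: ev_bif_true|apply: ev_bif_false].
  + exact: (@local_star (BMax IVar)).
  + exact: (@local_star (BCall f IVar)).
  + exact: (@local_star (BMax IVar)).
  move: h0 h1 => /= [_ -> /esym/negbT rN] [_ [_ -> ->] fy].
  have rSu : (rank y).+1 < size u by lia.
  have Syw : y.+1 < size w.
    case: (ltnP y.+1 (size w)) => // h; have wE : size w = y.+1 by lia.
    by have := rank_size w; rewrite wE; lia.
  apply: bsem_beval; exists y.+1; first by exists y => //=; lia.
  apply: onsucc_total => //; first by rewrite rSy.
  by rewrite rSy; move: fy; rewrite (minn_idPl _) //; lia.
- case=> -[h0 h1]; [apply: ev_bif_true|apply: ev_bif_false].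
  + exact: (@local_star (BMin IVar)).
  + exact: (@local_star (BCall f IVar)).
  + exact: (@local_star (BMin IVar)).
  move: h0 h1 => /= [_ -> /esym/negbT rN] [_ [_ -> ->] fy].
  case: y ny yw rN fy => [|y] ny yw rN fy; first by rewrite rank0 in rN.
  apply: bsem_beval; exists y; first by exists y.+1.
  by apply: onpred_total => //; lia.
Qed.

Lemma heval_enrich_complete y c i b :
  (forall f : fname N, guarded (body f)) -> guarded (Defs.head N c i) ->
  y < size w ->
  (if nth None w y is Some _ then heval N u (rank y) c i b else b = (c == None)) ->
  heval (enrich N) w y c i b.
Proof.
move=> gB gH yw; case e: (nth None w y) => [a|] H.
  have ny : nonblank y by rewrite e.
  apply: ev_bif_false.
    by apply: bsem_beval; exists y; rewrite // onth_blank // ny.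
  apply: guarded_star => //; move: (rank_lt ny) H => ru.
  apply: beval_bsem => // f z d zu H v vw nv vz.
  by apply: guarded_star; rewrite ?vz.
apply: ev_bif_true; first by apply: bsem_beval; exists y; rewrite // onth_blank // e.
by rewrite H; case: c {gH H} => [?|]; constructor.
Qed.

End Enrich.

(** * Guarded normal forms *)

Lemma guarded_normal (A F : Type) (T : bterm A F) : guarded T -> normal_term T.
Proof.
move=> [{}T lT|f|f] //; elim: T lT => //= [f []|T0 IH0 T1 IH1 T2 IH2] //.
by case/and3P=> /IH0 -> /IH1 -> /IH2 ->.
Qed.

Fixpoint idepth (A F : Type) (T : iterm A F) : nat :=
  match T with
  | IVar => 0
  | ISucc T | IPred T => (idepth T).+1
  | IIf T0 T1 T2 => maxn (bdepth T0) (maxn (idepth T1) (idepth T2))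
  end
with bdepth (A F : Type) (T : bterm A F) : nat :=
  match T with
  | BTrue | BFalse => 0
  | BCall _ T | BChar _ T | BMax T | BMin T => idepth T
  | BIf T0 T1 T2 => maxn (bdepth T0) (maxn (bdepth T1) (bdepth T2))
  end.

Section Normalise.
Variables (Sg Ga : finType) (m : nat) (pi : interp Sg m Ga).

(** Bounds the words of moves, which makes the names [(g, l)] a finite type. *)
Definition depth_bound : nat :=
  maxn (\max_(f : fname pi) bdepth (body f))
       (\max_(c : Sg * 'I_m) bdepth (Defs.head pi c.1 c.2)).

(* What is tested at the index reached: a function of [pi], a character, max
   ([inr true]) or min ([inr false]). *)
Definition test : finType := (fname pi + Ga + bool)%type.

(* The function (g, l) performs the moves [l] ([true] for S, [false] for P) and
   then the test [g]. *)
Definition nfname : finType := (test * depth_bound.-bseq bool)%type.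

(** S and P are peeled from the outside in, so the head of [l] is the innermost move, the first to
    be performed. A word beyond the bound would be sent by [insub_bseq] to the empty word; the depth
    hypotheses of [sem_norm] exclude this. *)
Fixpoint inorm (T : iterm Ga (fname pi)) (g : test) (l : seq bool) : bterm Ga nfname :=
  match T with
  | IVar => BCall (g, insub_bseq depth_bound l) IVar
  | ISucc T => inorm T g (true :: l)
  | IPred T => inorm T g (false :: l)
  | IIf T0 T1 T2 => BIf (bnorm T0) (inorm T1 g l) (inorm T2 g l)
  end
with bnorm (T : bterm Ga (fname pi)) : bterm Ga nfname :=
  match T with
  | BTrue => BTrue
  | BFalse => BFalse
  | BCall f T => inorm T (inl (inl f)) [::]
  | BChar a T => inorm T (inl (inr a)) [::]
  | BMax T => inorm T (inr true) [::]
  | BMin T => inorm T (inr false) [::]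
  | BIf T0 T1 T2 => BIf (bnorm T0) (bnorm T1) (bnorm T2)
  end.

(** Since S stays at the last index and P at the first, the guards do not change the meaning of a
    move. *)
Definition nfbody (h : nfname) : bterm Ga nfname :=
  let: (g, l) := h in
  let h' : nfname := (g, insub_bseq depth_bound (behead l)) in
  match l : seq bool with
  | [::] => match g with
            | inl (inl f) => bnorm (body f)
            | inl (inr a) => BChar a IVar
            | inr true => BMax IVar
            | inr false => BMin IVar
            end
  | true :: _ => BIf (BMax IVar) (BCall h' IVar) (BCall h' (ISucc IVar))
  | false :: _ => BIf (BMin IVar) (BCall h' IVar) (BCall h' (IPred IVar))
  end.

Definition normalise : interp Sg m Ga :=
  @Interp Sg m Ga nfname nfbody (fun a i => bnorm (Defs.head pi a i)).

Lemma norm_local :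
  (forall T g l, local_term (inorm T g l)) /\ (forall T, local_term (bnorm T)).
Proof.
by apply: term_mut => //= T0 IH0 T1 IH1 T2 IH2 *; rewrite IH0 IH1 IH2.
Qed.

Lemma guarded_normalise :
  (forall f : fname normalise, guarded (body f)) /\
  (forall a i, guarded (Defs.head normalise a i)).
Proof.
split=> [[g l]|a i]; last by constructor; apply: norm_local.2.
rewrite /= /nfbody; case: (bseqval l) => [|[] l']; try by constructor.
by constructor; case: g => [[f|a]|[]] //=; apply: norm_local.2.
Qed.

Variable s : seq Ga.

Definition move (d : bool) v := if d then minn v.+1 (size s).-1 else v.-1.

Definition test_sem (g : test) v b : Prop :=
  match g with
  | inl (inl f) => beval nfbody s v (bnorm (body f)) b
  | inl (inr a) => b = (onth s v == Some a)
  | inr true => b = (v == (size s).-1)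
  | inr false => b = (v == 0)
  end.

Lemma test_moves g (l : depth_bound.-bseq bool) v b : v < size s ->
  test_sem g (foldl (fun v d => move d v) v l) b -> callsem s nfbody (g, l) v b.
Proof.
have [k] := ubnP (size l); elim: k l v => // k IH l v le_k vs.
have {}IH d l' u : l = d :: l' :> seq bool -> u < size s ->
    test_sem g (foldl (fun v d => move d v) u l') b ->
    callsem s nfbody (g, insub_bseq depth_bound (behead l)) u b.
  (* The tail is within the bound, so [insub_bseq] returns it unchanged. *)
  move=> lE us; have vE : insub_bseq depth_bound (behead l) = l' :> seq bool.
    rewrite -[LHS]/(val _) /insub_bseq val_insubd lE ifT //=.
    by apply: leq_trans (leqnSn _) _; have := size_bseq l; rewrite lE.
  by move=> gu; apply: IH; rewrite ?vE //; move: le_k; rewrite lE.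
move: IH; rewrite /callsem /nfbody; case: (bseqval l) => [_|d l' /(_ d l' _ erefl) IH] /=.
  by case: g => [[f|a]|[]] //= -> //; apply: bsem_beval; exists v.
case: d IH => IH gl; apply: bsem_beval => /=.
- have [vE|vN] := eqVneq v (size s).-1.
    left; split; first by exists v; rewrite // vE eqxx.
    exists v => //; apply: IH => //.
    by move: gl; rewrite /move (_ : minn _ _ = v) //; lia.
  right; split; first by exists v; rewrite // (negbTE vN).
  by exists (move true v); [exists v|apply: IH => //=; rewrite /move; lia].
- have [vE|vN] := eqVneq v 0.
    left; split; first by exists v; rewrite // vE.
    by exists v => //; apply: IH => //; move: gl; rewrite /move vE.
  right; split; first by exists v; rewrite // (negbTE vN).
  by exists v.-1; [exists v|apply: IH => //; lia].
Qed.

Lemma sem_norm x : x < size s ->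
  let R f := test_sem (inl (inl f)) in
  (forall T g l v b, idepth T + size l <= depth_bound -> isem s R x T v ->
     test_sem g (foldl (fun v d => move d v) v l) b -> beval nfbody s x (inorm T g l) b) /\
  (forall T b, bdepth T <= depth_bound -> bsem s R x T b -> beval nfbody s x (bnorm T) b).
Proof.
move=> xs R; apply: term_mut => /=.
- move=> g l v b le_l -> gl; apply: bsem_beval; exists x => //.
  by apply: test_moves => //; rewrite /= /insub_bseq val_insubd ifT.
- move=> T IH g l v b le_l [u Tu ->] gl.
  by apply: (IH g (true :: l) u) => //=; rewrite addnS.
- move=> T IH g l v b le_l [u Tu ->] gl.
  by apply: (IH g (false :: l) u) => //=; rewrite addnS.
- move=> T0 IH0 T1 IH1 T2 IH2 g l v b le_l [[h0 h1]|[h0 h2]] gl.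
    by apply: ev_bif_true; [apply: IH0 h0|apply: IH1 h1 gl]; lia.
  by apply: ev_bif_false; [apply: IH0 h0|apply: IH2 h2 gl]; lia.
- by move=> b _ ->; constructor.
- by move=> b _ ->; constructor.
- by move=> f T IH b le_T [v Tv fv]; apply: (IH _ [::] v) => //; rewrite addn0.
- by move=> f T IH b le_T [v Tv fv]; apply: (IH _ [::] v) => //; rewrite addn0.
- by move=> T IH b le_T [v Tv fv]; apply: (IH _ [::] v) => //; rewrite addn0.
- by move=> T IH b le_T [v Tv fv]; apply: (IH _ [::] v) => //; rewrite addn0.
- move=> T0 IH0 T1 IH1 T2 IH2 b le_T [[h0 h1]|[h0 h2]].
    by apply: ev_bif_true; [apply: IH0 h0|apply: IH1 h1]; lia.
  by apply: ev_bif_false; [apply: IH0 h0|apply: IH2 h2]; lia.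
Qed.

(** Only one inclusion is proved here: the strictification of a well-defined interpretation is
    total, so determinism gives the converse in [normal_form_normalise]. *)
Lemma heval_normalise x a i b : x < size s -> heval pi s x a i b -> heval normalise s x a i b.
Proof.
move=> xs H; apply: (sem_norm xs).2.
  rewrite leq_max; apply/orP; right.
  exact: (@leq_bigmax _ (fun c : Sg * 'I_m => bdepth (Defs.head pi c.1 c.2)) (a, i)).
apply: beval_bsem H => // f y c ys; apply: (sem_norm ys).2.
by rewrite leq_max; apply/orP; left; apply: leq_bigmax.
Qed.

End Normalise.

(** * Well-defined interpretations and their output symbols *)

Section WellDefined.
Variables (Sg Ga : finType) (m : nat) (pi : interp Sg m Ga).
Hypothesis WDpi : well_defined pi.

Lemma heval_out s x a (i : 'I_m) b : x < size s ->
  heval pi s x a i b <-> b = (out_symbol pi s x i == Some a).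
Proof.
move=> xs; have [uniq_a total_a] := WDpi i xs.
have val c : heval pi s x a i c -> c = (out_symbol pi s x i == Some a).
  rewrite /out_symbol => H; case: pickP => [a' /asboolP H'|/(_ a)/asboolP H'].
    apply/esym; case: c H => H.
      by apply/eqP; rewrite (uniq_a _ _ H H').
    by apply/eqP=> -[e]; rewrite e in H'; have := beval_det xs H H'.
  by case: c H => // /H'.
split=> [|->]; first exact: val.
have [H|/total_a H] := pselect (heval pi s x a i true); by rewrite -(val _ H).
Qed.

Lemma heval_strictify s x c (i : 'I_m) b : x < size s ->
  heval (strictify pi) s x c i b <-> b = (out_symbol pi s x i == c).
Proof.
move=> xs; case: c => [a|]; first exact: heval_out.
set o := out_symbol pi s x i.
suff H : heval (strictify pi) s x None i (o == None).
  by split=> [|->] // /beval_det; apply.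
(* The nested conditional runs through the alphabet, so its value is put as a conjunction over
   [enum Sg] for the induction. *)
rewrite (_ : (o == None) = all (fun a => o != Some a) (enum Sg)); last first.
  case: o => [a|]; last by apply/esym/allP.
  by apply/esym/allPn; exists a; rewrite ?mem_enum // negbK.
rewrite /heval /=; elim: (enum Sg) => [|a l IH] /=; first exact: ev_true.
have: heval pi s x a i (o == Some a) by apply/heval_out.
case: (o == _) => H /=; last exact: ev_bif_false.
by apply: ev_bif_true => //; apply: ev_false.
Qed.

End WellDefined.

(** * Reindexing of the output lists *)

Lemma allpairs_iota_ord (T : Type) m k (f : nat -> 'I_m -> T) (g : nat -> T) :
  (forall x (i : 'I_m), g (x * m + i) = f x i) ->
  [seq f x i | x <- iota 0 k, i <- enum 'I_m] = map g (iota 0 (k * m)).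
Proof.
move=> gf; elim: k => [|k IH]; first by rewrite mul0n.
rewrite -addn1 iotaD allpairs_cat IH mulnDl mul1n iotaD map_cat /= cats0 add0n.
rewrite add0n; congr (_ ++ _).
have -> : iota (k * m) m = map (addn (k * m)) (map val (enum 'I_m)).
  by rewrite val_enum_ord -iotaDl addn0.
rewrite -!map_comp.
by apply: eq_map => i /=; rewrite gf.
Qed.

(** Induction from the right end, since [rank w y] depends only on the symbols before [y]: a new
    last letter adds the block of index [size (pmap id w)], a blank adds nothing. *)
Lemma pmap_rank (A B : Type) n (w : seq (option A)) (h : nat -> 'I_n -> option B) :
  pmap id [seq (if nth None w y is Some _ then h (rank w y) r else None) |
             y <- iota 0 (size w), r <- enum 'I_n] =
  pmap id [seq h z r | z <- iota 0 (size (pmap id w)), r <- enum 'I_n].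
Proof.
elim/last_ind: w => // w c IH.
rewrite size_rcons -[in LHS]addn1 iotaD allpairs_cat pmap_cat add0n /= cats0.
rewrite (_ : flatten _ = [seq (if nth None w y is Some _ then h (rank w y) r
  else None) | y <- iota 0 (size w), r <- enum 'I_n]).
  rewrite IH nth_rcons ltnn eqxx -cats1 pmap_cat size_cat iotaD allpairs_cat.
  rewrite pmap_cat add0n; congr (_ ++ _); case: c => [a|] /=.
    by rewrite cats0 /rank take_cat ltnn subnn take0 cats0 size_pmap.
  by elim: (enum 'I_n).
congr flatten; apply/eq_in_map => y; rewrite mem_iota add0n => /andP[_ yw].
by apply: eq_map => r; rewrite nth_rcons yw /rank -cats1 take_cat yw.
Qed.

Definition flat (T : Type) k (f : nat -> 'I_k -> option T) y : option T :=
  obind (f (y %/ k)) (insub (y %% k)).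

Lemma flatE (T : Type) k (f : nat -> 'I_k -> option T) x (i : 'I_k) :
  flat f (x * k + i) = f x i.
Proof.
have k_gt0 := leq_ltn_trans (leq0n i) (ltn_ord i).
by rewrite /flat divnMDl // modnMDl divn_small // modn_small // addn0 valK.
Qed.

(** Both lists number their entries alike, as [x * (m * n) + i = (x * m + i %/ n) * n + i %% n]. *)
Lemma allpairs_blocks (T : Type) m n k (f : nat -> 'I_n -> option T) :
  [seq f (x * m + i %/ n) (Ordinal (rem_lt i)) |
     x : nat <- iota 0 k, i : 'I_(m * n) <- enum 'I_(m * n)] =
  [seq f y r | y <- iota 0 (k * m), r <- enum 'I_n].
Proof.
rewrite [RHS](allpairs_iota_ord _ (flatE f)) -mulnA.
apply: allpairs_iota_ord => x i; rewrite -flatE /=; congr (flat f _).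
by rewrite [in LHS](divn_eq i n) mulnDl mulnA addnA.
Qed.

(** * Correctness of the composition *)

Section Composition.
Variables (De Sg Ga : finType) (m n : nat).
Variables (rho : interp De n Sg) (pi : interp Sg m Ga).
Hypotheses (WDrho : well_defined rho) (WDpi : well_defined pi).
Variable s : seq Ga.

(** The output of the strictified [pi] with its blanks kept; [pmap id blocks] is [denot pi s] by
    definition. *)
Definition blocks : seq (option Sg) :=
  [seq out_symbol pi s x i | x <- iota 0 (size s), i <- enum 'I_m].

Lemma size_blocks : size blocks = size s * m.
Proof. by rewrite size_allpairs size_iota size_enum_ord. Qed.

Lemma blocks_lt x (q : 'I_m) : x < size s -> x * m + q < size blocks.
Proof.
move=> xs; apply: (@leq_trans (x.+1 * m)); first by rewrite mulSnr ltn_add2l.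
by rewrite size_blocks leq_mul2r xs orbT.
Qed.

Lemma nth_blocks x (q : 'I_m) : x < size s ->
  nth None blocks (x * m + q) = out_symbol pi s x q.
Proof.
move=> xs; rewrite /blocks (allpairs_iota_ord _ (flatE _)).
have lt_xq := blocks_lt q xs; rewrite size_blocks in lt_xq.
by rewrite (nth_map 0) ?size_iota // nth_iota // add0n flatE.
Qed.

Definition out_blocks y (r : 'I_n) : option De :=
  if nth None blocks y is Some _ then out_symbol rho (denot pi s) (rank blocks y) r
  else None.

Lemma denot_out_blocks :
  denot rho (denot pi s) =
  pmap id [seq out_blocks (x * m + i %/ n) (Ordinal (rem_lt i)) |
             x : nat <- iota 0 (size s), i : 'I_(m * n) <- enum 'I_(m * n)].
Proof.
rewrite (allpairs_blocks m (size s) out_blocks) -size_blocks.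
by rewrite (pmap_rank blocks (out_symbol rho (denot pi s))).
Qed.

Variable N : interp (option De) n Sg.
Hypothesis nfN : normal_form_of (strictify rho) N.

Let out x (i : 'I_(m * n)) := out_blocks (x * m + i %/ n) (Ordinal (rem_lt i)).

Lemma heval_compose x d (i : 'I_(m * n)) b : x < size s ->
  heval (compose N pi) s x d i b <->
  heval (enrich N) blocks (x * m + i %/ n) (Some d) (Ordinal (rem_lt i)) b.
Proof.
move=> xs; have pi_blocks y c (r : 'I_m) v : y < size s ->
    heval (strictify pi) s y c r v <-> v = (onth blocks (y * m + r) == Some c).
  move=> ys; rewrite (heval_strictify WDpi) // (onth_eq None) ?blocks_lt //.
  by rewrite nth_blocks.
exact: (heval_scompose (enrich N) size_blocks pi_blocks (Some d) i b xs).
Qed.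

Lemma out_blocks_sem y d (r : 'I_n) b :
  (if nth None blocks y is Some _
   then heval N (denot pi s) (rank blocks y) (Some d) r b else b = false) <->
  b = (out_blocks y r == Some d).
Proof.
rewrite /out_blocks; case e: (nth None blocks y) => [a|] //.
have ry : rank blocks y < size (denot pi s) by apply: rank_lt; rewrite e.
by rewrite -nfN.2 // heval_strictify.
Qed.

(** Only soundness of the enrichment is used, so every normal form [N] is covered; that a value
    exists is shown separately, for guarded [N]. *)
Lemma heval_compose_out x d (i : 'I_(m * n)) b : x < size s ->
  heval (compose N pi) s x d i b -> b = (out x i == Some d).
Proof.
move=> xs /(heval_compose _ _ _ xs) H; apply/out_blocks_sem.
exact: (heval_enrich_sound nfN.1 (blocks_lt (Ordinal (quot_lt i)) xs) H).
Qed.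

Lemma heval_compose_total x d (i : 'I_(m * n)) : x < size s ->
  (forall f : fname N, guarded (body f)) -> (forall c r, guarded (Defs.head N c r)) ->
  heval (compose N pi) s x d i (out x i == Some d).
Proof.
move=> xs gB gH; apply/heval_compose => //; apply: heval_enrich_complete => //.
  exact: (blocks_lt (Ordinal (quot_lt i)) xs).
exact/out_blocks_sem.
Qed.

Lemma denot_compose : well_defined (compose N pi) ->
  denot (compose N pi) s = denot rho (denot pi s).
Proof.
move=> WD; rewrite denot_out_blocks; congr (pmap id (flatten _)).
apply/eq_in_map => x; rewrite mem_iota add0n => /andP[_ xs]; apply: eq_map => i.
(* Well-definedness supplies a value for every head, and [heval_compose_out] says which one it must
   be. *)
have outE d : (out_symbol (compose N pi) s x i == Some d) = (out x i == Some d).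
  by apply: heval_compose_out => //; apply/(heval_out WD).
rewrite -/(out x i); case e: (out_symbol _ s x i) => [d|].
  by apply/esym/eqP; rewrite -outE e.
by case e': (out x i) => [d|] //; have := outE d; rewrite e e' eqxx.
Qed.

End Composition.

Lemma normal_form_normalise (De Sg : finType) (n : nat) (rho : interp De n Sg) :
  well_defined rho -> normal_form_of (strictify rho) (normalise (strictify rho)).
Proof.
move=> WD; have [gB gH] := guarded_normalise (strictify rho).
split; first by split=> *; apply: guarded_normal.
move=> u y c r b yu; split=> [|H]; first exact: heval_normalise.
(* The strictification has a value here, which the normal form shares; by determinism it is the
   given one. *)
have total := (heval_strictify WD c r (out_symbol rho u y r == c) yu).2 erefl.
by rewrite (beval_det yu H (heval_normalise yu total)).
Qed.

(** A normal form may make the composition loop on trailing blanks, so the equality concerns those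
    with a well-defined composition; the first conjunct shows that such normal forms exist. *)
Theorem theorem4 (De Sg Ga : finType) (m n : nat)
    (rho : interp De n Sg) (pi : interp Sg m Ga)
    (Hrho : well_defined rho) (Hpi : well_defined pi) :
  (exists N : interp (option De) n Sg,
      normal_form_of (strictify rho) N /\ well_defined (compose N pi)) /\
  (forall N : interp (option De) n Sg,
      normal_form_of (strictify rho) N -> well_defined (compose N pi) ->
      denot (compose N pi) =1 denot rho \o denot pi).
Proof.
split=> [|N nfN WD s]; last exact: denot_compose.
have nfN := normal_form_normalise Hrho.
have [gB gH] := guarded_normalise (strictify rho).
exists (normalise (strictify rho)); split=> // s i x xs; split=> [a b Ha Hb|b nb].
  have := heval_compose_out Hrho Hpi nfN xs Ha.
  by have := heval_compose_out Hrho Hpi nfN xs Hb => /esym/eqP -> /esym/eqP[].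
have := heval_compose_total Hrho Hpi nfN b i xs gB gH.
by case: (_ == _).
Qed.
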